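(* Let $f=(f_1,f_2)$ and $g=(g_1,g_2)$ be IFS of positive Lipschitz contractions on the unit interval. Suppose that $\max\{f_1(0),f_1(1)\}\le\max\{f_2(0),f_2(1)\}$, that $f_1(0,1)\cap f_2(0,1)=\emptyset$, and that $f_1(0)=g_1(0)$, $f_2(0)=g_2(0)$, $g_1(x)\le f_1(x)$ and $g_2(x)\le f_2(x)$ for all $x\in[0,1]$. If $p=(p_1,1-p_1)$ and $q=(q_1,1-q_1)$ are probability vectors with $p_1\le q_1$, then $$W_1\left(\mu^{(f,p)},\mu^{(g,q)}\right)=\int_0^1 x\,d\left(\mu^{(f,p)}-\mu^{(g,q)}\right)(x).$$
   Context: A Lipschitz contraction is a map $h:\mathbb{R}\to\mathbb{R}$ with $\sup_{x\neq y}|h(x)-h(y)|/|x-y|<1$; it is positive if it is differentiable with derivative $>0$. An IFS of positive Lipschitz contractions on the unit interval is a finite tuple of positive Lipschitz contractions, each mapping $[0,1]$ into $[0,1]$. For an IFS $f=(f_1,f_2)$ and a probability vector $p=(p_1,p_2)$, the stationary probability measure $\mu^{(f,p)}$ is the unique Borel probability measure $\mu$ on $[0,1]$ with $\mu(A)=\sum_{i=1}^2 p_i\,\mu(f_i^{-1}(A))$ for all Borel sets $A$. The first Wasserstein distance is $W_1(\mu,\nu)=\inf\{\mathbb{E}|X-Y|:\mathrm{law}(X)=\mu,\ \mathrm{law}(Y)=\nu\}$. *)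

(* Defs.v *)
From HB Require Import structures.
From mathcomp Require Import all_boot all_order all_algebra.
From mathcomp Require Import all_classical all_reals all_analysis.
Import Order.TTheory GRing.Theory Num.Theory.
Import numFieldNormedType.Exports.

Set Implicit Arguments.
Unset Strict Implicit.
Unset Printing Implicit Defensive.

Local Open Scope classical_set_scope.
Local Open Scope ring_scope.

Definition lipschitz_contraction (R : realType) (h : R -> R) : Prop :=
  (ereal_sup [set (`|h z.1 - h z.2| / `|z.1 - z.2|)%:E
             | z in [set z : R * R | z.1 != z.2]] < 1)%E.

Definition positive_lipschitz_contraction (R : realType) (h : R -> R) : Prop :=
  lipschitz_contraction h /\ forall x : R, derivable h x 1 /\ 0 < h^`()%classic x.

Definition positive_ifs (R : realType) (n : nat) (f : 'I_n -> R -> R) : Prop :=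
  forall i, positive_lipschitz_contraction (f i) /\
            f i @` `[0, 1]%classic `<=` `[0, 1]%classic.

Definition probability_vector (R : realType) (n : nat) (p : 'I_n -> R) : Prop :=
  (forall i, 0 <= p i) /\ \sum_(i < n) p i = 1.

(* Borel probability measures on [0, 1] are represented as Borel probability
   measures on R giving mass 1 to [0, 1]; as every f i maps [0, 1] into itself,
   the self-similarity equation on Borel subsets of R and the one on Borel
   subsets of [0, 1] are the same. *)
Definition stationary_measure (R : realType) (n : nat) (f : 'I_n -> R -> R)
    (p : 'I_n -> R) (mu : probability R R) : Prop :=
  mu `[0, 1]%classic = 1%E /\
  forall A : set R, measurable A ->
    mu A = (\sum_(i < n) (p i)%:E * mu (f i @^-1` A))%E.

(* The two random variables live on a common, arbitrary probability space. *)
Definition W1 (R : realType)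
    (mu nu : probability R R) : \bar R :=
  ereal_inf [set e : \bar R |
    exists (d : measure_display) (T : measurableType d) (P : probability T R)
      (X Y : {RV P >-> R}),
      [/\ forall A : set R, measurable A -> distribution P X A = mu A,
          forall A : set R, measurable A -> distribution P Y A = nu A &
          e = ('E_P[fun w => (`|X w - Y w|)%R])%E]].

(* Main.v *)
Require Import Defs.
From HB Require Import structures.
From mathcomp Require Import all_boot all_order all_algebra.
From mathcomp Require Import all_classical all_reals all_analysis.
From mathcomp Require Import measurable_realfun lra.
Import Order.TTheory GRing.Theory Num.Theory.
Import numFieldNormedType.Exports.

Local Open Scope classical_set_scope.
Local Open Scope ring_scope.

(** Order the two laws stochastically: it suffices that the distribution
    function of [mu] lies below that of [nu], for then the quantile functions
    of the two laws, evaluated at one uniform random variable, give a coupling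
    with [Y <= X] everywhere. Its cost is the difference of the means, and no
    coupling can cost less, as [E|X - Y| >= E(X - Y)] ([W1_stochastic_order]).

    The stochastic order comes from self-similarity alone. Disjointness of the
    images of [f] gives [f_1 <= f_2] on the unit interval, so that moving from
    [f] to [g], and shifting mass from the second map to the first, can only
    push points down. Let [c < 1] be a common contraction ratio of the [f_i],
    and let [A], [B] be up-sets of the unit interval such that [B] contains the
    [c^n]-neighbourhood of [A]. Then [nu A <= mu B], by induction on [n]. For
    [n = 0] the neighbourhood is the whole interval or empty. If [B] contains
    the [c^(n+1)]-neighbourhood of [A], then [f_i^-1 B] contains the
    [c^n]-neighbourhood of [f_i^-1 A], so that
<<
    nu A = sum_i q_i nu(g_i^-1 A) <= sum_i q_i nu(f_i^-1 A)
        <= sum_i q_i mu(f_i^-1 B) <= sum_i p_i mu(f_i^-1 B) = mu B.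
>>
    The first inequality holds as [g_i <= f_i], the second by induction, the
    third as [f_1^-1 B] is contained in [f_2^-1 B] inside the unit interval
    and [p_1 <= q_1] ([stationary_upset_le]). Taking half-lines for [A] and
    [B] and letting [n] tend to infinity compares the distribution functions
    ([stationary_cdf_le]). The argument covers degenerate probability vectors,
    for which a contraction estimate on the difference of the distribution
    functions in the sup norm would fail. *)

(** * Positive contractions *)

Lemma positive_contraction_continuous {R : realType} (h : R -> R) (a b : R) :
  positive_lipschitz_contraction h -> {within `[a, b], continuous h}.
Proof.
by move=> [_ dh]; apply: derivable_within_continuous => z _; case: (dh z).
Qed.

Lemma positive_contraction_lt {R : realType} (h : R -> R) :
  positive_lipschitz_contraction h -> {homo h : x y / x < y}.
Proof.
move=> hP x y xy; have [_ dh] := hP.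
apply: (@gtr0_derive1_lt_cc _ h x y); rewrite ?in_itv/= ?lexx ?ltW//.
- by move=> z _; case: (dh z).
- by move=> z _; case: (dh z).
- exact: positive_contraction_continuous.
Qed.

Lemma positive_contraction_le {R : realType} (h : R -> R) :
  positive_lipschitz_contraction h -> {homo h : x y / x <= y}.
Proof. by move=> /positive_contraction_lt; exact: ltW_homo. Qed.

Lemma lipschitz_contraction_ratio {R : realType} (h : R -> R) :
  lipschitz_contraction h ->
  exists2 c : R, 0 <= c < 1 & forall x y, `|h x - h y| <= c * `|x - y|.
Proof.
rewrite /lipschitz_contraction; set S := (X in ereal_sup X) => S1.
have Sub x y : x != y -> ((`|h x - h y| / `|x - y|)%:E <= ereal_sup S)%E.
  by move=> xy; apply: ereal_sup_ubound; exists (x, y).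
have S0 : (0 <= ereal_sup S)%E.
  by apply: le_trans (Sub 0 1 _); rewrite ?lee_fin ?divr_ge0// eq_sym oner_eq0.
have Sfin : ereal_sup S \is a fin_num.
  by rewrite ge0_fin_numE// (lt_trans S1)// ltry.
exists (fine (ereal_sup S)).
  by rewrite fine_ge0//= -lte_fin fineK.
move=> x y; have [->|xy] := eqVneq x y; first by rewrite !subrr normr0 mulr0.
rewrite -ler_pdivrMr ?normr_gt0 ?subr_eq0//.
by rewrite -lee_fin fineK// Sub.
Qed.

Lemma positive_ifs_ratio {R : realType} {n : nat} {f : 'I_n -> R -> R} :
  positive_ifs f ->
  exists2 c : R, 0 <= c < 1 &
    forall i x y, `|f i x - f i y| <= c * `|x - y|.
Proof.
move=> fP.
have /choice[c cP] : forall i, exists c : R,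
    0 <= c < 1 /\ forall x y, `|f i x - f i y| <= c * `|x - y|.
  by move=> i; have [[/lipschitz_contraction_ratio[c]]] := fP i; exists c.
exists (\big[Order.max/0]_i c i).
  rewrite bigmax_ge_id/=; apply/bigmax_ltP; split => // i _.
  by have [/andP[]] := cP i.
move=> i x y; have [_ /(_ x y)/le_trans->//] := cP i.
by rewrite ler_wpM2r// le_bigmax.
Qed.

(** Increasing continuous maps have interval images, so disjointness of the
    images of the open unit interval puts one image entirely below the other;
    comparing the right ends tells which. *)
Lemma disjoint_images_le {R : realType} {h k : R -> R} :
    positive_lipschitz_contraction h -> positive_lipschitz_contraction k ->
    Num.max (h 0) (h 1) <= Num.max (k 0) (k 1) ->
    (h @` `]0, 1[) `&` (k @` `]0, 1[) = set0 ->
  h 1 <= k 0.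
Proof.
move=> hP kP; have [h01 k01] : h 0 < h 1 /\ k 0 < k 1.
  by split; exact: positive_contraction_lt.
rewrite (max_r (ltW h01)) (max_r (ltW k01)) => h1k1 hk0.
rewrite leNgt; apply/negP => k0h1.
(* the midpoint of the overlap lies strictly inside both images *)
pose v := (Num.max (h 0) (k 0) + h 1) / 2.
have hv : h 0 < v < h 1.
  by rewrite /v; case: (leP (h 0) (k 0)) => ?; apply/andP; split; lra.
have kv : k 0 < v < k 1.
  by rewrite /v; case: (leP (h 0) (k 0)) => ?; apply/andP; split; lra.
have ivt (l : R -> R) : positive_lipschitz_contraction l -> l 0 < v < l 1 ->
    (l @` `]0, 1[) v.
  move=> lP /andP[l0v vl1].
  have [|x] := @IVT _ l 0 1 v ler01 (positive_contraction_continuous _ _ _ lP).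
    by rewrite ge_min le_max (ltW l0v) (ltW vl1) orbT.
  rewrite in_itv/= => /andP[x0 x1] lxv; exists x => //.
  rewrite /= in_itv/= !lt_neqAle x0 x1 !andbT; apply/andP; split.
    by apply: contra_ltN l0v => /eqP->; rewrite lxv.
  by apply: contra_ltN vl1 => /eqP<-; rewrite lxv.
have : set0 v by rewrite -hk0; split; exact: ivt.
by [].
Qed.

(** * Probability measures carried by the unit interval *)

Lemma unit_itvC_null {R : realType} {mu : probability R R} :
  mu `[0, 1]%classic = 1%E -> mu (~` `[0, 1]%classic) = 0%E.
Proof.
by move=> mu1; rewrite probability_setC// [X in (_ - X)%E]mu1 subee.
Qed.

Lemma le_measure_unit_itv {R : realType} (mu : probability R R) (A B : set R) :
  mu `[0, 1]%classic = 1%E -> measurable A -> measurable B ->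
  A `&` `[0, 1] `<=` B -> (mu A <= mu B)%E.
Proof.
move=> mu1 mA mB AB.
have mC : measurable (~` `[0, 1]%classic : set R) by exact: measurableC.
have muC := unit_itvC_null mu1.
rewrite -[leRHS]adde0 -muC (le_trans _ (measureU2 _ _ _))//.
rewrite le_measure ?inE//; first exact: measurableU.
move=> x Ax; have [x01|x01] := pselect (`[0, 1]%classic x); last by right.
by left; apply: AB.
Qed.

Lemma cdf_itv_right_continuous {R : realType} (mu : probability R R) :
  right_continuous (fun t => mu `]-oo, t]%classic).
Proof.
pose idR : R -> R := idfun.
pose idR_mfun := isMeasurableFun.Build _ _ _ _ idR (@measurable_id _ _ setT).
pose X : {RV mu >-> R} := HB.pack idR idR_mfun.
exact: (@cdf_right_continuous _ _ _ mu X).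
Qed.

(** The open right half-lines are stable under intersection and generate the
    Borel sets. *)
Lemma probability_cdf_unique {R : realType} (m1 m2 : probability R R) :
    (forall t, m1 `]-oo, t]%classic = m2 `]-oo, t]%classic) ->
  forall A, measurable A -> m1 A = m2 A.
Proof.
move=> m12.
apply: (measure_unique (@RGenOInfty.G R) (fun k => `](- k%:R)%R, +oo[%classic)).
- exact: RGenOInfty.measurableE.
- move=> _ _ [x ->] [y ->]; exists (Num.max x y).
  by apply/seteqP; split=> z /=; rewrite !in_itv/= !andbT gt_max => /andP.
- by move=> k; exists (- k%:R).
- apply/seteqP; split=> // x _; exists (Num.bound `|x|) => //=.
  by rewrite in_itv/= andbT ltrNl (le_lt_trans (ler_norm _))// normrN archi_boundP.
- move=> _ [x ->].
  have : m1 (~` `]-oo, x]%classic) = m2 (~` `]-oo, x]%classic).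
    by rewrite !probability_setC// m12.
  by rewrite setCitvl.
- by move=> k; rewrite (le_lt_trans (probability_le1 _ _))// ltry.
Qed.

Lemma integrable_id_unit_itv {R : realType} {mu : probability R R} :
  mu `[0, 1]%classic = 1%E -> mu.-integrable setT (EFin : R -> \bar R).
Proof.
move=> mu1.
have mabs : measurable_fun setT (fun x : R => `|x%:E|%E) by exact: measurableT_comp.
apply/integrableP; split; first exact: EFin_measurable.
have muC := unit_itvC_null mu1.
rewrite (ge0_negligible_integral (measurableC (measurable_itv `[0, 1])))//.
rewrite setTD setCK.
apply: (@le_lt_trans _ _ (\int[mu]_(x in `[0%R, 1%R]%classic) cst 1 x)%E).
  apply: ge0_le_integral => //; first exact: measurable_funTS.
  move=> x; rewrite /= in_itv/= => /andP[x0 x1].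
  by rewrite lee_fin ger0_norm.
by rewrite integral_cst// [X in (_ * X)%E]mu1 mule1 ltry.
Qed.

(** * Stochastic order of the stationary measures *)

(** [A] meets the unit interval in an up-set of it; nothing is asked of the
    part of [A] outside, which is null for the measures considered. *)
Definition upset01 {R : realType} (A : set R) :=
  forall x y, 0 <= x -> x <= y -> y <= 1 -> A x -> A y.

Section stochastic_order.
Context {R : realType} {f g : 'I_2 -> R -> R} {p q : 'I_2 -> R}.
Context {mu nu : probability R R} {c : R}.
Hypothesis hf : positive_ifs f.
Hypothesis hg : positive_ifs g.
Hypothesis f01 : f ord0 1 <= f ord_max 0.
Hypothesis gf : forall i x, 0 <= x <= 1 -> g i x <= f i x.
Hypothesis hp : probability_vector p.
Hypothesis hq : probability_vector q.
Hypothesis hpq : p ord0 <= q ord0.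
Hypothesis hmu : stationary_measure f p mu.
Hypothesis hnu : stationary_measure g q nu.
Hypothesis fc : forall i x y, `|f i x - f i y| <= c * `|x - y|.
Hypothesis c0 : 0 <= c.

Let f_unit i x : 0 <= x <= 1 -> 0 <= f i x <= 1.
Proof.
move=> x01; have [_ fi] := hf i.
by have := fi (f i x); rewrite /= in_itv/=; apply; exists x; rewrite //= in_itv.
Qed.

Let g_unit i x : 0 <= x <= 1 -> 0 <= g i x <= 1.
Proof.
move=> x01; have [_ gi] := hg i.
by have := gi (g i x); rewrite /= in_itv/=; apply; exists x; rewrite //= in_itv.
Qed.

Let f_nd i : {homo f i : x y / x <= y}.
Proof. by have [/positive_contraction_le] := hf i. Qed.

Let g_nd i : {homo g i : x y / x <= y}.
Proof. by have [/positive_contraction_le] := hg i. Qed.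

Let f_meas i A : measurable A -> measurable (f i @^-1` A).
Proof.
by move=> mA; rewrite -[X in measurable X]setTI; exact: nondecreasing_measurable.
Qed.

Let g_meas i A : measurable A -> measurable (g i @^-1` A).
Proof.
by move=> mA; rewrite -[X in measurable X]setTI; exact: nondecreasing_measurable.
Qed.

Let f_upset i A : upset01 A -> upset01 (f i @^-1` A).
Proof.
move=> uA x y x0 xy y1 /=.
have x01 : 0 <= x <= 1 by rewrite x0 (le_trans xy).
have y01 : 0 <= y <= 1 by rewrite y1 (le_trans x0).
apply: uA; last by have /andP[] := f_unit i y y01.
  by have /andP[] := f_unit i x x01.
exact: f_nd.
Qed.

(** A mixture of two numbers increases when mass moves to the larger one; the
    upper bound only serves to keep them finite. *)
Let mixture_le (a b : \bar R) : (0 <= a)%E -> (a <= b)%E -> (b <= 1)%E ->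
  ((q ord0)%:E * a + (q ord_max)%:E * b <=
   (p ord0)%:E * a + (p ord_max)%:E * b)%E.
Proof.
move=> a0 ab b1.
have bfin : b \is a fin_num.
  by rewrite ge0_fin_numE ?(le_trans a0)// (le_lt_trans b1)// ltry.
have afin : a \is a fin_num by rewrite ge0_fin_numE// (le_lt_trans ab)// ltey_eq bfin.
move: a b afin bfin a0 ab b1 => [a| |] [b| |]// _ _.
rewrite -!EFinM -!EFinD !lee_fin => a0 ab b1.
have [_] := hp; have [_] := hq.
rewrite !big_ord_recl !big_ord0 !addr0 (_ : lift ord0 ord0 = ord_max); last exact/val_inj.
by move: hpq; nra.
Qed.

(** The comparison of [nu] and [mu] up to an error of size [c ^+ n] in space. *)
Lemma stationary_upset_le n (A B : set R) : measurable A -> measurable B ->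
    upset01 A -> upset01 B ->
    (forall x y, A x -> 0 <= x <= 1 -> 0 <= y <= 1 -> `|x - y| <= c ^+ n -> B y) ->
  (nu A <= mu B)%E.
Proof.
have [mu1 muE] := hmu; have [nu1 nuE] := hnu.
elim: n A B => [|n IHn] A B mA mB uA uB AB.
  (* [c ^+ 0] is the diameter of the unit interval, so that [B] contains it as
     soon as [A] meets it *)
  have [[x [Ax /=]]|A0] := pselect (A `&` `[0, 1] !=set0).
    rewrite in_itv/= => x01.
    have -> : mu B = 1%E.
      apply/eqP; rewrite eq_le probability_le1//= -mu1.
      rewrite le_measure ?inE// => y; rewrite /= in_itv/= => y01.
      by apply: (AB x) => //; rewrite expr0 ler_norml; lra.
    exact: probability_le1.
  rewrite (le_trans (le_measure_unit_itv nu A set0 nu1 mA _ _))//.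
    by move=> x Ax; apply: A0; exists x.
  by rewrite measure0.
rewrite nuE// muE//.
have step i : (nu (g i @^-1` A) <= mu (f i @^-1` B))%E.
  apply: (@le_trans _ _ (nu (f i @^-1` A))).
    apply: le_measure_unit_itv nu1 _ _ _; [exact: g_meas|exact: f_meas|].
    move=> x [/= Agx]; rewrite in_itv/= => x01.
    apply: uA Agx; last by have /andP[] := f_unit i x x01.
      by have /andP[] := g_unit i x x01.
    exact: gf.
  apply: IHn; [exact: f_meas|exact: f_meas|exact: f_upset|exact: f_upset|].
  move=> x y /= Afx x01 y01 xy; apply: AB Afx _ _ _; [exact: f_unit..|].
  by rewrite (le_trans (fc i x y))// exprS ler_wpM2l.
rewrite !big_ord_recl !big_ord0 !adde0 (_ : lift ord0 ord0 = ord_max); last exact/val_inj.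
apply: (@le_trans _ _ ((q ord0)%:E * mu (f ord0 @^-1` B) +
                       (q ord_max)%:E * mu (f ord_max @^-1` B))%E).
  by apply: leeD; apply: lee_wpmul2l; rewrite ?lee_fin ?step//; case: hq.
apply: mixture_le => //.
- apply: le_measure_unit_itv mu1 _ _ _; [exact: f_meas|exact: f_meas|].
  move=> x [/= Bf0x]; rewrite in_itv/= => x01.
  have /andP[x0 x1] := x01.
  apply: uB Bf0x.
  + by have /andP[] := f_unit ord0 x x01.
  + by rewrite (le_trans (f_nd ord0 _ _ x1))// (le_trans f01)// f_nd.
  + by have /andP[] := f_unit ord_max x x01.
- by apply: probability_le1; exact: f_meas.
Qed.

(** Stationary measures are ordered: since the error [c ^+ n] tends to 0,
    right-continuity of distribution functions removes it. *)
Lemma stationary_cdf_le t : c < 1 -> (mu `]-oo, t]%classic <= nu `]-oo, t]%classic)%E.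
Proof.
move=> c1.
have shift d : 0 < d -> (mu `]-oo, t]%classic <= nu `]-oo, (t + d)%R]%classic)%E.
  move=> d0.
  have [n cnd] : exists n, c ^+ n < d.
    have cn0 : (c ^+ n @[n --> \oo] --> (0 : R)) by apply: cvg_expr; rewrite ger0_norm.
    have [n _ /(_ n (leqnn n))] := cvgr_lt _ cn0 _ d0.
    by exists n.
  have : (nu `[(t + d)%R, +oo[%classic <= mu `]t, +oo[%classic)%E.
    apply: (@stationary_upset_le n) => //.
    - by move=> x y _ xy _; rewrite /= !in_itv/= !andbT => /le_trans; exact.
    - by move=> x y _ xy _; rewrite /= !in_itv/= !andbT => /lt_le_trans; exact.
    - move=> x y; rewrite /= !in_itv/= !andbT => tdx _ _.
      by rewrite ler_norml => /andP[_]; lra.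
  rewrite -setCitvl probability_setC// -setCitvl probability_setC// => H.
  have : (mu `]-oo, t]%classic <= nu `]-oo, (t + d)%R[%classic)%E.
    rewrite -[leLHS](fineK (fin_num_measure _ _ _))// -[leRHS](fineK (fin_num_measure _ _ _))//.
    rewrite lee_fin; move: H.
    rewrite -[X in (_ - X <= _)%E](fineK (fin_num_measure _ _ _))//.
    rewrite -[X in (_ <= _ - X)%E](fineK (fin_num_measure _ _ _))//.
    by rewrite -!EFinB lee_fin; lra.
  move=> /le_trans; apply; rewrite le_measure ?inE//.
  by move=> x; rewrite /= !in_itv/=; exact: ltW.
apply: (cvge_ge _ (cdf_itv_right_continuous nu t)).
near=> x; rewrite -[x](subrKC t); apply: shift.
by rewrite subr_gt0; near: x; exact: nbhs_right_gt.
Unshelve. all: by end_near. Qed.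

End stochastic_order.

(** * Quantile functions and the monotone coupling *)

Lemma uniform_prob_itvNyc {R : realType} (a : R) : 0 <= a <= 1 ->
  uniform_prob (@ltr01 R) `]-oo, a]%classic = a%:E.
Proof.
move=> /andP[a0 a1]; rewrite /uniform_prob integral_uniform_pdf.
have -> : `]-oo, a]%classic `&` `[0, 1]%classic = `[0, a]%classic :> set R.
  apply/seteqP; split=> x /=; rewrite !in_itv/=; first by case=> -> /andP[->].
  by move=> /andP[-> xa]; rewrite xa (le_trans xa).
rewrite (eq_integral (cst 1%E)).
  rewrite integral_cst//= mul1e lebesgue_measure_itv/= lte_fin oppr0 adde0.
  by case: ltgtP a0 => // <-.
move=> x; rewrite inE/= in_itv/= => /andP[x0 xa].
by rewrite /uniform_pdf x0 (le_trans xa a1)/= subr0 invr1.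
Qed.

(** The quantile function of a probability measure carried by [[0, 1]].
    Capping the level at 1 and restricting to nonnegative points makes it
    total, with values in [[0, 1]]. *)
Definition quantile01 {R : realType} (mu : probability R R) (u : R) : R :=
  inf [set t | 0 <= t /\ ((Num.min u 1)%:E <= mu `]-oo, t]%classic)%E].

Section quantile01.
Context {R : realType} {mu : probability R R}.
Hypothesis mu1 : mu `[0, 1]%classic = 1%E.
Local Notation Q := (quantile01 mu).
Local Notation level u :=
  [set t : R | 0 <= t /\ ((Num.min u 1)%:E <= mu `]-oo, t]%classic)%E].

Let cdf1 : mu `]-oo, 1]%classic = 1%E.
Proof.
apply/eqP; rewrite eq_le probability_le1//= -mu1 le_measure ?inE//.
by move=> x; rewrite /= !in_itv/= => /andP[].
Qed.

Let cdf_nd (s t : R) : s <= t -> (mu `]-oo, s]%classic <= mu `]-oo, t]%classic)%E.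
Proof. by move=> st; rewrite le_measure ?inE//; exact: subset_itvl. Qed.

Let level1 u : level u 1.
Proof. by split=> //; rewrite cdf1 lee_fin ge_min lexx orbT. Qed.

Let level_lb u : lbound (level u) 0.
Proof. by move=> t []. Qed.

Lemma quantile01_ge0 u : 0 <= Q u.
Proof. by apply: lb_le_inf; [exists 1|]. Qed.

(** Galois connection between the quantile and the distribution function;
    attainment of the infimum is right-continuity. *)
Lemma quantile01_le u t : 0 <= t ->
  (Q u <= t) = ((Num.min u 1)%:E <= mu `]-oo, t]%classic)%E.
Proof.
move=> t0; apply/idP/idP => [Qt|ut]; last first.
  by apply: ge_inf; [exists 0; exact: level_lb|split].
apply: (cvge_ge _ (cdf_itv_right_continuous mu t)); near=> x.
have tx : t < x by near: x; exact: nbhs_right_gt.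
have [||s [_ us]] := @inf_adherent R (level u) (x - Q u).
- by rewrite subr_gt0 (le_lt_trans Qt).
- by split; [exists 1|exists 0; exact: level_lb].
rewrite addrC subrK => sx.
by rewrite (le_trans us)// cdf_nd// ltW.
Unshelve. all: by end_near. Qed.

Lemma quantile01_nd : {homo Q : u v / u <= v}.
Proof.
move=> u v uv; rewrite quantile01_le ?quantile01_ge0//.
have : Q v <= Q v by [].
rewrite quantile01_le ?quantile01_ge0//; apply: le_trans.
by rewrite lee_fin le_min ge_min uv/= ge_min lexx orbT.
Qed.

Lemma measurable_quantile01 : measurable_fun setT Q.
Proof. exact: nondecreasing_measurable measurableT quantile01_nd. Qed.

Lemma pushforward_quantile01 t :
  uniform_prob (@ltr01 R) (Q @^-1` `]-oo, t]) = mu `]-oo, t]%classic.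
Proof.
have mu_le1 := probability_le1 mu (measurable_itv `]-oo, t]).
have mufin : mu `]-oo, t]%classic \is a fin_num by exact: fin_num_measure.
have [t0|t0] := ltP t 0.
  have -> : Q @^-1` `]-oo, t] = set0.
    apply/seteqP; split=> // u; rewrite /= in_itv/= => Qt.
    by have := lt_le_trans t0 (le_trans (quantile01_ge0 u) Qt); rewrite ltxx.
  rewrite measure0; apply/esym/eqP; rewrite -measure_le0.
  rewrite (le_trans (le_measure_unit_itv mu _ set0 mu1 _ _ _)) ?measure0//.
  move=> x [/=]; rewrite !in_itv/= => xt /andP[x0 _].
  by have := lt_le_trans t0 (le_trans x0 xt); rewrite ltxx.
have [mut1|mut1] := leP 1%E (mu `]-oo, t]%classic).
  have -> : Q @^-1` `]-oo, t] = setT.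
    apply/seteqP; split=> // u _; rewrite /= in_itv/= quantile01_le//.
    by rewrite (le_trans _ mut1)// lee_fin ge_min lexx orbT.
  by rewrite probability_setT; apply/eqP; rewrite eq_le mut1 mu_le1.
rewrite -[in RHS](fineK mufin) -uniform_prob_itvNyc; last first.
  by rewrite fine_ge0//= -lee_fin fineK.
congr (uniform_prob _ _); apply/seteqP; split=> u; rewrite /= !in_itv/=.
  rewrite quantile01_le// -[in X in X -> _](fineK mufin) lee_fin ge_min => /orP[//|].
  by rewrite leNgt -lte_fin fineK// mut1.
by move=> ut; rewrite quantile01_le// -(fineK mufin) lee_fin ge_min ut.
Qed.

End quantile01.

Lemma quantile01_mono {R : realType} (mu nu : probability R R) u :
    mu `[0, 1]%classic = 1%E -> nu `[0, 1]%classic = 1%E ->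
    (forall t, mu `]-oo, t]%classic <= nu `]-oo, t]%classic)%E ->
  quantile01 nu u <= quantile01 mu u.
Proof.
move=> mu1 nu1 munu; have Q0 := quantile01_ge0 mu1 u.
rewrite quantile01_le// (le_trans _ (munu _))//.
by rewrite -quantile01_le.
Qed.

(** The monotone coupling realises a stochastically ordered pair of laws on
    [[0, 1]] by pointwise ordered random variables. *)
Lemma monotone_coupling {R : realType} {mu nu : probability R R} :
    mu `[0, 1]%classic = 1%E -> nu `[0, 1]%classic = 1%E ->
    (forall t, mu `]-oo, t]%classic <= nu `]-oo, t]%classic)%E ->
  exists X Y : {RV uniform_prob (@ltr01 R) >-> R},
    [/\ forall A, measurable A -> distribution (uniform_prob (@ltr01 R)) X A = mu A,
        forall A, measurable A -> distribution (uniform_prob (@ltr01 R)) Y A = nu A &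
        forall u, Y u <= X u].
Proof.
move=> mu1 nu1 munu.
pose mX := isMeasurableFun.Build _ _ (measurableTypeR R) R _
  (measurable_quantile01 mu1).
pose mY := isMeasurableFun.Build _ _ (measurableTypeR R) R _
  (measurable_quantile01 nu1).
pose X : {RV uniform_prob (@ltr01 R) >-> R} := HB.pack (quantile01 mu) mX.
pose Y : {RV uniform_prob (@ltr01 R) >-> R} := HB.pack (quantile01 nu) mY.
exists X, Y; split=> [||u]; last exact: quantile01_mono.
- apply: (@probability_cdf_unique R (distribution _ X) mu).
  exact: pushforward_quantile01.
- apply: (@probability_cdf_unique R (distribution _ Y) nu).
  exact: pushforward_quantile01.
Qed.

(** * The Wasserstein distance between ordered laws *)

Section mean.
Context {R : realType} {d : measure_display} {T : measurableType d}.
Context {P : probability T R} {mu : probability R R} {X : {RV P >-> R}}.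
Hypothesis mu1 : mu `[0, 1]%classic = 1%E.
Hypothesis Xmu : forall A, measurable A -> distribution P X A = mu A.

Lemma integrable_law_unit_itv : P.-integrable setT (EFin \o X).
Proof.
have mabs : measurable_fun setT (fun x : R => `|x%:E|%E) by exact: measurableT_comp.
apply/integrableP; split; first exact/measurable_EFinP.
have := integrable_id_unit_itv mu1 => /integrableP[_].
rewrite (eq_measure_integral (distribution P X)); last first.
  by move=> A mA _; exact/esym/Xmu.
by rewrite (ge0_integral_distribution X mabs).
Qed.

Lemma mean_law_unit_itv :
  (\int[P]_w (X w)%:E = \int[mu]_(x in `[0%R, 1%R]%classic) x%:E)%E.
Proof.
rewrite -(integral_distribution _ integrable_law_unit_itv)//.
rewrite (eq_measure_integral mu); last by move=> A mA _; exact: Xmu.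
have muC := unit_itvC_null mu1.
rewrite (negligible_integral (measurableC (measurable_itv `[0, 1])))//.
  by rewrite setTD setCK.
exact: integrable_id_unit_itv.
Qed.

End mean.

(** For laws carried by [[0, 1]], a stochastically larger one is at distance
    the difference of the means: every coupling costs at least that much, and
    the monotone one exactly that much. *)
Lemma W1_stochastic_order {R : realType} {mu nu : probability R R} :
    mu `[0, 1]%classic = 1%E -> nu `[0, 1]%classic = 1%E ->
    (forall t, mu `]-oo, t]%classic <= nu `]-oo, t]%classic)%E ->
  W1 mu nu = (\int[mu]_(x in `[0%R, 1%R]%classic) x%:E -
              \int[nu]_(x in `[0%R, 1%R]%classic) x%:E)%E.
Proof.
move=> mu1 nu1 munu; apply/eqP; rewrite eq_le; apply/andP; split.
  have [X [Y [Xmu Ynu YX]]] := monotone_coupling mu1 nu1 munu.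
  apply: ge_ereal_inf; exists 'E_(uniform_prob ltr01)[fun w => (`|X w - Y w|)%R]%E.
    by exists _, _, (uniform_prob ltr01), X, Y.
  rewrite unlock -(mean_law_unit_itv mu1 Xmu) -(mean_law_unit_itv nu1 Ynu).
  rewrite -integralB//; [|exact: integrable_law_unit_itv mu1 Xmu
                         |exact: integrable_law_unit_itv nu1 Ynu].
  rewrite [leLHS](eq_integral (fun w => (X w)%:E - (Y w)%:E)%E)// => w _.
  by rewrite ger0_norm ?subr_ge0.
apply: le_ereal_inf_tmp => _ [d [T [P [X [Y [Xmu Ynu ->]]]]]].
rewrite unlock -(mean_law_unit_itv mu1 Xmu) -(mean_law_unit_itv nu1 Ynu).
have iX := integrable_law_unit_itv mu1 Xmu.
have iY := integrable_law_unit_itv nu1 Ynu.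
have iXY : P.-integrable setT (fun w => (X w)%:E - (Y w)%:E)%E.
  exact: integrableB.
rewrite -integralB//; apply: le_integral => //.
  exact: (integrable_abse iXY).
by move=> w _; rewrite -EFinB lee_fin ler_norm.
Qed.

Theorem theorem2p8 (R : realType) (f g : 'I_2 -> R -> R) (p q : 'I_2 -> R)
    (mu nu : probability R R)
    (hf : positive_ifs f) (hg : positive_ifs g)
    (hmax : Num.max (f ord0 0) (f ord0 1) <=
            Num.max (f ord_max 0) (f ord_max 1))
    (hdisj : (f ord0 @` `]0, 1[%classic) `&` (f ord_max @` `]0, 1[%classic) = set0)
    (h0 : f ord0 0 = g ord0 0) (h1 : f ord_max 0 = g ord_max 0)
    (hgf0 : forall x : R, x \in `[0, 1] -> g ord0 x <= f ord0 x)
    (hgf1 : forall x : R, x \in `[0, 1] -> g ord_max x <= f ord_max x)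
    (hp : probability_vector p) (hq : probability_vector q)
    (hpq : p ord0 <= q ord0)
    (hmu : stationary_measure f p mu) (hnu : stationary_measure g q nu) :
  W1 mu nu = (\int[mu]_(x in `[0%R, 1%R]%classic) x%:E -
              \int[nu]_(x in `[0%R, 1%R]%classic) x%:E)%E.
Proof.
have [c /andP[c0 c1] fc] := positive_ifs_ratio hf.
have f01 : f ord0 1 <= f ord_max 0.
  by apply: disjoint_images_le hmax hdisj; [case: (hf ord0)|case: (hf ord_max)].
have gf i x : 0 <= x <= 1 -> g i x <= f i x.
  case: i => -[|[|//]] i2 x01; rewrite (bool_irrelevance i2 isT).
    by rewrite (_ : Ordinal _ = ord0); [exact: hgf0|exact/val_inj].
  by rewrite (_ : Ordinal _ = ord_max); [exact: hgf1|exact/val_inj].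
apply: W1_stochastic_order; [by case: hmu|by case: hnu|].
by move=> t; exact: (stationary_cdf_le hf hg f01 gf hp hq hpq hmu hnu fc c0).
Qed.
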